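(* Let $n\ge 2$ and let $\Phi$ be an integrator for Hamiltonian systems in $\mathbb{R}^{2n}$. Let $H(q,p)=p_1^2/2$ on $\mathbb{R}^{2n}$, and let $U\subset\mathbb{R}^{2n}$ be an open neighbourhood of the set $\{((q_1,0,\dots,0),(1,0,\dots,0))\mid q_1\in\mathbb{R}\}$. Suppose: (1) $\Phi$ is consistent for $H$ (at every point of $\mathbb{R}^{2n}$); (2) $\Phi$ is computationally reasonable; (3) $\Phi$ conserves energy for any Hamiltonian, any point $(q,p)$ and any $\Delta t$ for which it is defined; (4) whenever a Hamiltonian $G(q,p)$ on $\mathbb{R}^{2n}$ is independent of the variables $(q_i,p_i)$ for some $i$, then $\pi_i\Phi(G,(q,p),\Delta t)=(q_i,p_i)$ for all $(q,p)$ and $\Delta t$ for which $\Phi$ is defined; (5) for sufficiently small $\Delta t$, $\Phi(H,(q,p),\Delta t)$ is defined, continuous in $(q,p)$, and conserves volume for $(q,p)\in U$. Then for all sufficiently small $\Delta t>0$ there is a $C_0^\infty$ function $V:\mathbb{R}\to\mathbb{R}$ such that, if $\widetilde H(q,p)=p_1^2/2+V(q_1)$, then $\Phi(\widetilde H,\cdot,\Delta t)$ is not simultaneously defined, continuous, and volume-conserving on $U$. Moreover, for each such $\Delta t$, $V$ can be chosen so that the same conclusion holds with $V$ replaced by $\lambda V$ for every $\lambda\in(0,1)$.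
   Context: Phase space is $\mathbb{R}^{2n}$ with coordinates $(q,p)$, $q=(q_1,\dots,q_n)$, $p=(p_1,\dots,p_n)\in\mathbb{R}^n$; $\pi_i(q,p)=(q_i,p_i)$ for $i=1,\dots,n$. The Hamiltonian system of $H:\mathbb{R}^{2n}\to\mathbb{R}$ is $dq/dt=\partial H/\partial p$, $dp/dt=-\partial H/\partial q$; its time-$t$ flow map is denoted $S^t$. Integrator: a function $\Phi$ that takes as arguments a Hamiltonian $H:\mathbb{R}^{2n}\to\mathbb{R}$, a point $(q,p)\in\mathbb{R}^{2n}$ and a step $\Delta t\in[0,\infty)$, and either returns a point $\Phi(H,(q,p),\Delta t)\in\mathbb{R}^{2n}$ or is not defined (so it is a partial function). For a multi-index $\alpha\in\mathbb{N}_0^{2n}$, $\partial_\alpha H=\frac{\partial^{\alpha_1}}{\partial q_1^{\alpha_1}}\cdots\frac{\partial^{\alpha_n}}{\partial q_n^{\alpha_n}}\frac{\partial^{\alpha_{n+1}}}{\partial p_1^{\alpha_{n+1}}}\cdots\frac{\partial^{\alpha_{2n}}}{\partial p_n^{\alpha_{2n}}}H$. Computationally reasonable: $\Phi$ is computationally reasonable if for each $H:\mathbb{R}^{2n}\to\mathbb{R}$, $(q,p)\in\mathbb{R}^{2n}$ and $\Delta t\ge 0$ there exist $m\in\mathbb{N}_0$, points $(r^j,s^j)\in\mathbb{R}^{2n}$ and multi-indices $\alpha^j\in\mathbb{N}_0^{2n}$, $j=1,\dots,m$, such that for any $\widetilde H:\mathbb{R}^{2n}\to\mathbb{R}$ with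 $\partial_{\alpha^j}\widetilde H(r^j,s^j)=\partial_{\alpha^j}H(r^j,s^j)$ for $j=1,\dots,m$, either $\Phi(H,(q,p),\Delta t)=\Phi(\widetilde H,(q,p),\Delta t)$ or both are not defined. (Hamiltonians are understood to be smooth, so that these derivatives exist.) Consistent: $\Phi$ is consistent at $(q,p)$ for the Hamiltonian $H$ with flow $S^t$ if $\lim_{\Delta t\to 0}\|S^{\Delta t}(q,p)-\Phi(H,(q,p),\Delta t)\|/\Delta t=0$ (limit over $\Delta t>0$). Energy conservation: $H(\Phi(H,(q,p),\Delta t))=H(q,p)$. Volume conservation of a map $\Psi$ on $U$: $\mathrm{vol}(\Psi(A))=\mathrm{vol}(A)$ for all bounded open $A\subset U$. $C_0^\infty$ means smooth with compact support. *)

(* Defs.v *)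
From HB Require Import structures.
From mathcomp Require Import all_boot all_order all_algebra.
From mathcomp Require Import all_classical all_reals all_analysis.
Set Implicit Arguments.
Unset Strict Implicit.
Unset Printing Implicit Defensive.
Import Order.TTheory GRing.Theory Num.Theory.
Import numFieldNormedType.Exports.
Local Open Scope classical_set_scope.
Local Open Scope ring_scope.

(* A point is x = (q, p), with q_i = x.1 0 i and p_i = x.2 0 i.  Indices run   *)
(* from 0: the coordinates usually written q_1, p_1 have index 0.              *)
Notation phase R n := ('rV[R]_n * 'rV[R]_n)%type.

Section PhaseSpace.
Context {R : realType} {n : nat}.
Local Notation E := (phase R n).
Implicit Types (f G H : E -> R) (x y : E) (A U : set E) (V : R -> R).

(* [inl i] stands for the variable q_i and [inr i] for the variable p_i. *)
Definition basis_vec (c : 'I_n + 'I_n) : E :=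
  match c with
  | inl i => (delta_mx 0 i, 0)
  | inr i => (0, delta_mx 0 i)
  end.

Definition coord (c : 'I_n + 'I_n) x : R :=
  match c with
  | inl i => x.1 0 i
  | inr i => x.2 0 i
  end.

Definition partial (c : 'I_n + 'I_n) f : E -> R :=
  fun x => 'D_(basis_vec c) f x.

(* C^oo: iterated partial derivatives of every order, taken in any order of    *)
(* the variables, exist everywhere and are continuous.                         *)
Definition smooth f : Prop :=
  forall s : seq ('I_n + 'I_n),
    continuous (foldr partial f s) /\
    (forall x c, derivable (foldr partial f s) x (basis_vec c)).

(* The derivative with respect to p_n is applied first and the one with        *)
(* respect to q_1 last.                                                        *)
Definition mpartial (alpha : 'I_n + 'I_n -> nat) f : E -> R :=
  foldr (fun i g => iter (alpha (inl i)) (partial (inl i)) g)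
    (foldr (fun i g => iter (alpha (inr i)) (partial (inr i)) g) f
      (enum 'I_n))
    (enum 'I_n).

Definition hamiltonian_field H x : E :=
  (\row_i partial (inr i) H x, - \row_i partial (inl i) H x).

Definition is_hamiltonian_flow H (S : R -> E -> E) : Prop :=
  forall x, S 0 x = x /\
    forall t : R,
      is_derive t 1 (fun s : R => S s x) (hamiltonian_field H (S t x)).

(* Phi H x dt = None means that Phi is not defined there.  Only the values at  *)
(* smooth H and dt >= 0 are meaningful; no notion below constrains the others. *)
Definition integrator : Type := (E -> R) -> E -> R -> option E.
Implicit Types Phi : integrator.

(* The existence of the limit includes that Phi H x dt is defined for all      *)
(* small dt > 0.                                                               *)
Definition consistent_at Phi H (S : R -> E -> E) x : Prop :=
  exists psi : R -> E,
    (\forall dt \near 0^'+, Phi H x dt = Some (psi dt)) /\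
    (fun dt : R => `|S dt x - psi dt| / dt) @ 0^'+ --> (0 : R).

Definition computationally_reasonable Phi : Prop :=
  forall H x (dt : R), smooth H -> 0 <= dt ->
    exists (m : nat) (r : 'I_m -> E) (alpha : 'I_m -> 'I_n + 'I_n -> nat),
      forall H' : E -> R, smooth H' ->
        (forall j, mpartial (alpha j) H' (r j) = mpartial (alpha j) H (r j)) ->
        Phi H x dt = Phi H' x dt.

Definition energy_conserving Phi : Prop :=
  forall H x (dt : R) y, smooth H -> 0 <= dt ->
    Phi H x dt = Some y -> H y = H x.

Definition independent_of (i : 'I_n) G : Prop :=
  forall x y,
    (forall j, j != i -> x.1 0 j = y.1 0 j /\ x.2 0 j = y.2 0 j) ->
    G x = G y.

Definition preserves_decoupled Phi : Prop :=
  forall G (i : 'I_n) x (dt : R) y, smooth G -> 0 <= dt ->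
    independent_of i G -> Phi G x dt = Some y ->
    y.1 0 i = x.1 0 i /\ y.2 0 i = x.2 0 i.

Definition open_box (ab : E * E) : set E :=
  [set x | forall c, coord c ab.1 < coord c x < coord c ab.2].

Definition box_volume (ab : E * E) : R :=
  \prod_(c : 'I_n + 'I_n) (coord c ab.2 - coord c ab.1).

(* 2n-dimensional Lebesgue outer measure: the infimum of the total volume of   *)
(* countable covers by open boxes.  It is the Lebesgue measure on measurable   *)
(* sets, in particular on open sets and on their images under continuous maps, *)
(* which are countable unions of compact sets.                                 *)
Definition vol A : \bar R :=
  ereal_inf [set (\sum_(0 <= k <oo) (box_volume (B k))%:E)%E |
    B in [set B : nat -> E * E |
            (forall k c, coord c (B k).1 <= coord c (B k).2) /\
            A `<=` \bigcup_k open_box (B k)]].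

Definition volume_conserving_on U (Psi : E -> E) : Prop :=
  forall A, open A -> bounded_set A -> A `<=` U -> vol (Psi @` A) = vol A.

Definition regular_step_on U Phi H (dt : R) : Prop :=
  exists Psi : E -> E,
    [/\ forall x, U x -> Phi H x dt = Some (Psi x),
        {within U, continuous Psi} &
        volume_conserving_on U Psi].

Definition kinetic (i : 'I_n) : E -> R := fun x => (x.2 0 i) ^+ 2 / 2.

Definition with_potential (i : 'I_n) V : E -> R :=
  fun x => kinetic i x + V (x.1 0 i).

Definition axis_line (i : 'I_n) : set E :=
  [set x | exists q : R, x = (q *: delta_mx 0 i, delta_mx 0 i)].

End PhaseSpace.

Arguments integrator : clear implicits.

Definition test_function (R : realType) (V : R -> R) : Prop :=
  (forall (k : nat) (t : R), derivable (derive1n k V) t 1) /\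
  compact (closure [set t | V t != 0]).

(* Main.v *)
(** Along the axis the unperturbed step is q_1 |-> f(q_1) with f(0) < 1 < f(1), by consistency for small steps.
    Conservation of energy and of the idle coordinates confines the image of a thin tube around the axis to
    the corresponding energy shells, so comparing volumes gives f(1) - f(0) >= 1 for H.  A potential supported
    in ]1, f(1)[ away from the finitely many points sampled by Phi at q_1 = 0 and q_1 = 1 leaves f(0) and f(1)
    unchanged.  The tube over [0, 1] is unperturbed too, but its image must fill the energy shells over
    ]f(0), f(1)[, and these are thicker in p_1 where the potential is positive: the image has too much volume. *)

(* Of a regular step only continuity, volume and the conservation laws are known; it need not be
   injective or open. Upper bounds on volume come from enclosing a set in one box. For lower bounds,
   [vol] being an infimum over covers, the indicators of an arbitrary cover are integrated one
   coordinate at a time. That an image contains a whole fibred set comes from the intermediate value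
   theorem along lines parallel to the axis: energy and the idle coordinates determine everything
   but q_1 and the sign of p_1. The bound 1/4 on the potential is below the kinetic energy 1/2 on
   the axis, so p_1 cannot vanish and keeps its sign. The gain is of first order in the radius e of
   the tube: where the potential is w, a shell of width 2e widens to at least 2e(1 + w). Relative to
   the cross-section of the tube this does not depend on e, so it survives in arbitrarily thin
   tubes, which are needed to map the ends of the tube close to f(0) and f(1). The sampled points of
   [Phi] vary with the starting point, so the perturbed f is known at 0 and 1 only; the comparison
   uses nothing else about its values. *)
From HB Require Import structures.
From mathcomp Require Import all_boot all_order all_algebra.
From mathcomp Require Import all_classical all_reals all_analysis.
From mathcomp Require Import measurable_realfun measurable_fun_approximation.
From mathcomp Require Import ring lra.
Require Import Defs.
Set Implicit Arguments.
Unset Strict Implicit.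
Unset Printing Implicit Defensive.
Import Order.TTheory GRing.Theory Num.Theory.
Import numFieldNormedType.Exports.
Local Open Scope classical_set_scope.
Local Open Scope ring_scope.

(** * Lower bounds for the outer measure *)

Section OuterMeasure.
Context {R : realType}.

Lemma integral_scaled_itv (m l u : R) : 0 <= m -> l <= u ->
  (\int[lebesgue_measure]_z (m * \1_`]l, u[%classic z)%:E = (m * (u - l))%:E)%E.
Proof.
move=> m0 lu; under eq_integral do rewrite EFinM.
rewrite ge0_integralZl_EFin//; last first.
- exact/measurable_EFinP/measurable_indic.
have -> : (\int[lebesgue_measure]_z (\1_`]l, u[%classic z)%:E =
    lebesgue_measure (`]l, u[%classic : set R))%E.
  by rewrite integral_indic// setIT.
rewrite lebesgue_measure_itv/= lte_fin EFinM.
move: lu; rewrite le_eqVlt => /predU1P[->|->]; last by rewrite EFinB.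
by rewrite ltxx subrr.
Qed.

(** Two step functions on the left are all that the fibred estimate needs: the width of a fibre is
    bounded below by one constant on a large interval plus a bonus on a small one, so the width
    itself never has to be measurable. *)
Lemma integral_itv_cover (m m' l u l' u' : R) (c a b : nat -> R) :
  0 <= m -> 0 <= m' -> l <= u -> l' <= u' ->
  (forall k, 0 <= c k) -> (forall k, a k <= b k) ->
  (forall z, (m * \1_`]l, u[%classic z + m' * \1_`]l', u'[%classic z)%:E <=
     \sum_(0 <= k <oo) (c k * \1_`]a k, b k[%classic z)%:E)%E ->
  ((m * (u - l) + m' * (u' - l'))%:E <=
    \sum_(0 <= k <oo) (c k * (b k - a k))%:E)%E.
Proof.
move=> m0 m'0 lu l'u' c0 ab le.
have meas (d p q : R) : measurable_fun [set: R]
    (fun z => (d * \1_`]p, q[%classic z)%:E).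
  by apply/measurable_EFinP; exact: measurable_funM.
have ge0 (d p q z : R) : 0 <= d -> (0 <= (d * \1_`]p, q[%classic z)%:E)%E.
  by move=> d0; rewrite lee_fin mulr_ge0// indicE; case: (_ \in _).
rewrite EFinD -!integral_scaled_itv// -ge0_integralD//;
  [|by [exact: meas|move=> z _; exact: ge0]..].
rewrite (eq_eseriesr (g := fun k => \int[lebesgue_measure]_z
   (c k * \1_`]a k, b k[%classic z)%:E)%E); last first.
  by move=> k _; rewrite integral_scaled_itv.
rewrite -integral_nneseries//;
  [|by move=> k; exact: meas|by move=> k z _; exact: ge0].
apply: ge0_le_integral => //.
- by move=> z _; rewrite adde_ge0 ?ge0.
- by apply: emeasurable_funD; exact: meas.
- apply: ge0_emeasurable_sum => [k z _ _|k _]; [exact: ge0|exact: meas].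
- by move=> z _; rewrite -EFinD.
Qed.

Section Slices.
Context {C : finType}.
Implicit Types (a b : nat -> C -> R) (y : C -> R).

Definition upd y (c0 : C) (z : R) : C -> R := fun c => if c == c0 then z else y c.

(* The volume of the slice through y, along the coordinates in s, of the box with corners a and b. *)
Definition slice_volume (s : {pred C}) (a b y : C -> R) : R :=
  \prod_c (if c \in s then b c - a c else \1_`]a c, b c[%classic (y c)).

(** Fubini in the single coordinate [c0]: as a function of [y c0], each slice volume is a constant
    times the indicator of one side of the box, and integration turns this indicator into the length
    of the side. *)
Lemma slice_cover_step a b (s s' : seq C) (c0 : C) y (m m' l u l' u' : R) :
  (forall k c, a k c <= b k c) -> c0 \notin s -> s' =i c0 :: s ->
  0 <= m -> 0 <= m' -> l <= u -> l' <= u' ->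
  (forall z, (m * \1_`]l, u[%classic z + m' * \1_`]l', u'[%classic z)%:E <=
     \sum_(0 <= k <oo) (slice_volume (mem s) (a k) (b k) (upd y c0 z))%:E)%E ->
  ((m * (u - l) + m' * (u' - l'))%:E <=
    \sum_(0 <= k <oo) (slice_volume (mem s') (a k) (b k) y)%:E)%E.
Proof.
move=> ab c0s s'E m0 m'0 lu l'u' le.
pose d k := \prod_(c | c != c0)
  (if c \in s then b k c - a k c else \1_`]a k c, b k c[%classic (y c)).
rewrite (eq_eseriesr (g := fun k => (d k * (b k c0 - a k c0))%:E)); last first.
  move=> k _; rewrite /slice_volume (bigD1 c0)//= mulrC s'E mem_head.
  congr (_ * _)%:E; apply: eq_bigr => c cc0.
  by rewrite -[c \in mem s']/(c \in s') s'E in_cons (negbTE cc0).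
apply: integral_itv_cover => // [k|z].
  apply: prodr_ge0 => c _; case: ifP => _; first by rewrite subr_ge0.
  by rewrite indicE; case: (_ \in _).
apply: le_trans (le z) _.
rewrite (eq_eseriesr (g := fun k => (d k * \1_`]a k c0, b k c0[%classic z)%:E)).
  exact: lexx.
move=> k _; rewrite /slice_volume (bigD1 c0)//= mulrC.
rewrite -[c0 \in mem s]/(c0 \in s) (negbTE c0s) {2}/upd eqxx.
congr (_ * _)%:E; apply: eq_bigr => c cc0.
by rewrite /upd (negbTE cc0).
Qed.

(** The coordinates of [s] are integrated one after the other, starting from the fact that a box
    containing [y] contributes 1. The predicate [A] holds the constraints on the coordinates outside
    [s], hence its stability under changes inside [s]. *)
Lemma slice_cover (A : (C -> R) -> Prop) a b (l u : C -> R) (s : seq C) :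
  (forall k c, a k c <= b k c) -> (forall c, l c <= u c) -> uniq s ->
  (forall y, A y -> (forall c, c \in s -> l c < y c < u c) ->
    exists k, forall c, a k c < y c < b k c) ->
  (forall y c z, c \in s -> A y -> A (upd y c z)) ->
  forall y, A y ->
  ((\prod_(c <- s) (u c - l c))%:E <=
     \sum_(0 <= k <oo) (slice_volume (mem s) (a k) (b k) y)%:E)%E.
Proof.
move=> ab lu us cov updA.
(* Here [t] lists the coordinates already integrated, and [t'] those still frozen at a value inside
   their interval. *)
suff: forall (t t' : seq C), uniq (t ++ t') -> (t ++ t') =i s ->
    forall y, A y -> (forall c, c \in t' -> l c < y c < u c) ->
  ((\prod_(c <- t) (u c - l c))%:E <=
     \sum_(0 <= k <oo) (slice_volume (mem t) (a k) (b k) y)%:E)%E.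
  move=> h y Ay; apply: (h s [::]) => //; first by rewrite cats0.
  by rewrite cats0.
have sv0 t k y : 0 <= slice_volume (mem t) (a k) (b k) y.
  apply: prodr_ge0 => c _; case: ifP => _; first by rewrite subr_ge0.
  by rewrite indicE; case: (_ \in _).
elim=> [|c0 t IH] t' ut tE y Ay yt'.
  have [k yk] : exists k, forall c, a k c < y c < b k c.
    by apply: cov => // c; rewrite -tE/=; exact: yt'.
  apply: (@le_trans _ _ (\sum_(0 <= j < k.+1)
      (slice_volume (mem [::]) (a j) (b j) y)%:E)%E); last first.
    by apply: nneseries_lim_ge => j _ _; rewrite lee_fin.
  rewrite sumEFin lee_fin big_nil big_nat_recr// -[leLHS]add0r lerD//.
    by apply: sumr_ge0 => j _; exact: sv0.
  rewrite /slice_volume big1// => c _.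
  by rewrite /= indicE mem_set//= in_itv/= yk.
(* Only one step function is needed here; the second is taken to be zero on an empty interval. *)
rewrite big_cons (_ : _ * _ =
  \prod_(c <- t) (u c - l c) * (u c0 - l c0) + 0 * (0 - 0)); last by ring.
have c0t : c0 \notin t.
  by move: ut => /= /andP[+ _]; rewrite mem_cat negb_or => /andP[].
apply: (slice_cover_step ab c0t) => //.
  by rewrite prodr_ge0// => c _; rewrite subr_ge0.
move=> z; rewrite mul0r addr0 indicE.
have [|_] := boolP (z \in `]l c0, u c0[%classic); last first.
  by rewrite mulr0; apply: nneseries_ge0 => k _ _; rewrite lee_fin.
rewrite inE/= in_itv/= mulr1 => zI; apply: (IH (c0 :: t')).
- by rewrite -cat1s uniq_catCA.
- by move=> c; rewrite -tE !mem_cat !in_cons orbCA orbA.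
- by apply: updA => //; rewrite -tE mem_cat mem_head.
- move=> c; rewrite /upd in_cons; case: eqP => [->//|_] /=; exact: yt'.
Qed.

End Slices.
End OuterMeasure.

Section Volume.
Context {R : realType} {n : nat}.
Local Notation E := (phase R n).
Local Notation C := ('I_n + 'I_n)%type.
Implicit Types (x y : E) (A U : set E) (c : C).

Definition of_coord (g : C -> R) : E :=
  (\row_i g (inl i), \row_i g (inr i)).

Lemma coord_of_coord g c : coord c (of_coord g) = g c.
Proof. by case: c => i /=; rewrite mxE. Qed.

Lemma coord_inj x y : (forall c, coord c x = coord c y) -> x = y.
Proof.
case: x y => [q p] [q' p'] xy; congr pair; apply/rowP => i.
  exact: (xy (inl i)).
exact: (xy (inr i)).
Qed.

Lemma vol_open_box_le A (ab : E * E) : (0 < n)%N ->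
  (forall c, coord c ab.1 <= coord c ab.2) -> A `<=` open_box ab ->
  (vol A <= (box_volume ab)%:E)%E.
Proof.
move=> n0 abP Aab; apply: ereal_inf_lbound => /=.
exists (fun k => if k == 0%N then ab else (0, 0)).
  split=> [[|k] c|x /Aab xab]; [exact: abP|exact: lexx|by exists 0%N].
(* The padding boxes have volume 0 because some side has length 0; for [n = 0] the empty product
   would be 1. *)
have bv0 : box_volume ((0, 0) : E * E) = 0.
  by rewrite /box_volume (bigD1 (inl (Ordinal n0)))//= subrr mul0r.
rewrite nneseries_recl//; last first.
  move=> [|k] _; rewrite lee_fin/= ?bv0//.
  by apply: prodr_ge0 => c _; rewrite subr_ge0.
by rewrite eseries0 ?adde0// => -[|k]//= _ _; rewrite bv0.
Qed.

(* Fubini for a set fibred over the q_i-axis: the fibres are the intervals ]f q, g q[ in the variable p_i,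
   times a fixed box in the other variables. *)
Lemma vol_ge_fibred A (i : 'I_n) (l u : C -> R) (f g : R -> R)
    (a b j k h h' : R) :
  a <= b -> j <= k -> 0 <= h -> 0 <= h' -> (forall c, l c <= u c) ->
  (forall q, a < q < b -> f q <= g q) ->
  (forall q, a < q < b -> h <= g q - f q) ->
  (forall q, j < q < k -> a < q < b /\ h + h' <= g q - f q) ->
  (forall x, a < coord (inl i) x < b ->
    f (coord (inl i) x) < coord (inr i) x < g (coord (inl i) x) ->
    (forall c, c != inl i -> c != inr i -> l c < coord c x < u c) -> A x) ->
  (((h * (b - a) + h' * (k - j)) *
     \prod_(c | (c != inl i) && (c != inr i)) (u c - l c))%:E <= vol A)%E.
Proof.
move=> ab jk h0 h'0 lu fg hfg hh'fg subA.
apply: le_ereal_inf_tmp => _ [B [hB AB] <-].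
pose lo m c := coord c (B m).1; pose up m c := coord c (B m).2.
have loup m c : lo m c <= up m c by exact: hB.
(* Order of integration: the fixed box first, then p_i, whose interval depends on q_i, and q_i
   last. *)
pose s0 := [seq c <- index_enum C | (c != inl i) && (c != inr i)].
pose s1 := inr i :: s0; pose s2 := inl i :: s1.
set K := \prod_(c | _) _.
have KE : K = \prod_(c <- s0) (u c - l c) by rewrite big_filter.
have K0 : 0 <= K by apply: prodr_ge0 => c _; rewrite subr_ge0.
have s0P c : (c \in s0) = (c != inl i) && (c != inr i).
  by rewrite mem_filter mem_index_enum andbT.
have step0 (y : C -> R) : a < y (inl i) < b -> f (y (inl i)) < y (inr i) < g (y (inl i)) ->
    (K%:E <= \sum_(0 <= m <oo) (slice_volume (mem s0) (lo m) (up m) y)%:E)%E.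
  move=> y1 y2; rewrite KE.
  apply: (@slice_cover _ _ (fun y : C -> R => a < y (inl i) < b /\
     f (y (inl i)) < y (inr i) < g (y (inl i)))) => //.
  - by rewrite filter_uniq// index_enum_uniq.
  - move=> z [z1 z2] zs0.
    have /AB[m _ zm] : A (of_coord z).
      apply: subA; rewrite ?coord_of_coord// => c ci ci'.
      by rewrite coord_of_coord zs0// s0P ci.
    by exists m => c; rewrite -[z c]coord_of_coord; exact: zm.
  - by move=> z c w; rewrite s0P /upd => /andP[/negbTE + /negbTE];
      rewrite ![_ == c]eq_sym => -> ->.
have step1 (y : C -> R) : a < y (inl i) < b ->
    ((K * (g (y (inl i)) - f (y (inl i))))%:E <=
      \sum_(0 <= m <oo) (slice_volume (mem s1) (lo m) (up m) y)%:E)%E.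
  move=> y1; rewrite (_ : K * _ =
    K * (g (y (inl i)) - f (y (inl i))) + 0 * (0 - 0)); last by ring.
  apply: (slice_cover_step (s := s0) (c0 := inr i)) => //.
  - by rewrite s0P eqxx andbF.
  - exact: fg.
  move=> z; rewrite mul0r addr0 indicE.
  have [|_] := boolP (z \in _); last first.
    rewrite mulr0; apply: nneseries_ge0 => m _ _; rewrite lee_fin.
    apply: prodr_ge0 => c _; case: ifP => _; first by rewrite subr_ge0.
    by rewrite indicE; case: (_ \in _).
  rewrite inE/= in_itv/= mulr1 => zI; apply: step0.
    exact: y1.
  by rewrite -[upd _ _ _ (inl i)]/(y (inl i)) /upd eqxx.
(* The base point [fun=> 0] is arbitrary: once q_i is integrated no coordinate is left free. *)
have := @slice_cover_step _ _ lo up s1 s2 (inl i) (fun=> 0) (h * K) (h' * K)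
  a b j k.
rewrite (_ : h * K * _ + _ = (h * (b - a) + h' * (k - j)) * K); last by ring.
move=> /(_ loup); rewrite in_cons s0P eqxx/= => /(_ isT (fun=> erefl)).
rewrite !mulr_ge0// => /(_ isT isT ab jk) H.
apply: le_trans (H _) _; last first.
  rewrite le_eqVlt; apply/orP; left; apply/eqP; apply: eq_eseriesr => m _.
  congr _%:E; apply: eq_bigr => c _.
  rewrite -[_ \in mem s2]/(c \in s2) !in_cons s0P.
  by case: (c == inl i) => //; case: (c == inr i).
move=> z; have [zab|zab] := boolP (a < z < b); last first.
  have zjk : ~~ (j < z < k) by apply: contra zab => /hh'fg[].
  rewrite !indicE !memNset ?mulr0 ?addr0/= ?in_itv/=; [|exact/negP..].
  apply: nneseries_ge0 => m _ _; rewrite lee_fin.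
  apply: prodr_ge0 => c _; case: ifP => _; first by rewrite subr_ge0.
  by rewrite indicE; case: (_ \in _).
have uz : upd (fun=> 0) (inl i : C) z (inl i) = z by rewrite /upd eqxx.
have := step1 (upd (fun=> 0) (inl i : C) z); rewrite uz => /(_ zab).
apply: le_trans; rewrite lee_fin (_ : _ + _ =
  K * (h * \1_`]a, b[%classic z + h' * \1_`]j, k[%classic z)); last by ring.
rewrite ler_wpM2l// !indicE (mem_set (_ : `]a, b[%classic z)) ?mulr1/= ?in_itv//.
have [zjk|zjk] := boolP (j < z < k).
  rewrite mem_set/= ?in_itv//= mulr1; exact: (hh'fg z zjk).2.
rewrite memNset/= ?in_itv/=; last exact/negP.
by rewrite mulr0 addr0 hfg.
Qed.

End Volume.

(** * Neighbourhoods of a segment in phase space *)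

Section Topology.
Context {R : realType} {n : nat}.
Local Notation E := (phase R n).
Local Notation C := ('I_n + 'I_n)%type.
Implicit Types (x y : E) (A O U : set E) (c : C).

Lemma continuous_coord c : continuous (coord c : E -> R).
Proof.
move=> x; case: c => i /=.
  by apply: (continuous_comp (f := fst) (g := fun v : 'rV[R]_n => v 0 i));
    [exact: cvg_fst|exact: coord_continuous].
by apply: (continuous_comp (f := snd) (g := fun v : 'rV[R]_n => v 0 i));
    [exact: cvg_snd|exact: coord_continuous].
Qed.

Lemma nbhs_coord x O : nbhs x O ->
  exists2 e : R, 0 < e & forall y, (forall c, `|coord c y - coord c x| < e) -> O y.
Proof.
move=> /nbhs_ballP[e /= e0 eO]; exists e => // y xy; apply: eO.
split; split => // j k; rewrite /ball/= distrC ord1.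
  exact: (xy (inl k)).
exact: (xy (inr k)).
Qed.

Lemma open_open_box (ab : E * E) : open (open_box ab).
Proof.
rewrite openE => x abx.
apply: (@filter_forall E C
  (fun c => [set y : E | coord c ab.1 < coord c y < coord c ab.2]) (nbhs x)) => c.
have [lx xu] := andP (abx c); have cx := @continuous_coord c x; near=> y; apply/andP; split.
  by near: y; apply: cvgr_gt cx _ lx.
by near: y; apply: cvgr_lt cx _ xu.
Unshelve. all: by end_near. Qed.

Lemma bounded_open_box (ab : E * E) : bounded_set (open_box ab).
Proof.
change (\forall M \near +oo, forall x, open_box ab x -> `|x| <= M).
near=> M => x abx; have M0 : 0 < M by near: M; exact: nbhs_pinfty_gt.
suff : ball (0 : E) M x by rewrite -ball_normE/= sub0r normrN => /ltW.
suff xM c : `|coord c x| < M.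
  split; split => // j k; rewrite /ball/= !mxE sub0r normrN ord1.
    exact: (xM (inl k)).
  exact: (xM (inr k)).
apply: (@le_lt_trans _ _ (`|coord c ab.1| + `|coord c ab.2|)); last first.
  by move: c; near: M; apply: (@filter_forall R C
    (fun c => [set M | `|coord c ab.1| + `|coord c ab.2| < M])) => c;
  exact: nbhs_pinfty_gt.
have /andP[xl xu] := abx c.
rewrite ler_norml; have := ler_norm (coord c ab.2).
have := lerNnormlW (lexx `|coord c ab.1|); have := normr_ge0 (coord c ab.1).
have := normr_ge0 (coord c ab.2); lra.
Unshelve. all: by end_near. Qed.

(** Compactness of [[a, b]] gives one radius that serves all points of the segment, as in the tube
    lemma. *)
Lemma tube_nbhs (c0 : C) (g : C -> R) (a b : R) O :
  (forall s, a <= s <= b -> nbhs (of_coord (upd g c0 s)) O) ->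
  exists2 e0 : R, 0 < e0 & forall e y, e <= e0 -> a <= coord c0 y <= b ->
    (forall c, c != c0 -> `|coord c y - g c| < e) -> O y.
Proof.
move=> gO.
pose P (e : R) (s : R) := forall y, coord c0 y = s ->
    (forall c, c != c0 -> `|coord c y - g c| < e) -> O y.
have /compact_near_coveringP/(_ R (0^'+) P _) := @segment_compact R a b.
case.
  move=> s; rewrite /= in_itv/= => /gO/nbhs_coord[e e0 eO].
  exists (ball s e, [set d | d <= e]) => /=.
    split; first exact: nbhsx_ballx.
    exact: nbhs_right_le.
  move=> [t d] [/= st de] y yt yg; apply: eO => c; rewrite coord_of_coord /upd.
  have [->|cc0] := eqVneq c c0; last exact: lt_le_trans (yg c cc0) de.
  by rewrite yt distrC.
move=> e /= e0 eP.
(* Membership in the filter [0^'+] covers only radii strictly between 0 and [e]. *)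
exists (e / 2); rewrite ?divr_gt0// => d y de yab yg.
apply: (eP (e / 2) _ _ (coord c0 y)) => //=.
- by rewrite sub0r normrN gtr0_norm ?divr_gt0// ltr_pdivrMr// ltr_pMr// ltr1n.
- by rewrite divr_gt0.
- by move=> c cc0; exact: lt_le_trans (yg c cc0) de.
Qed.

End Topology.

(** * Volume comparison along the axis *)

(** The roots A and B are the momenta at potential w with the energies of momenta 1 + e and 1 - e at
    potential 0. Since A^2 - B^2 = 4e, the width is 4e / (A + B). The tangent bound sqrt(y^2 - 2w)
    <= y - w/y at y = 1 + e and y = 1 - e gives A + B <= 2 - 2w, and (1 + w)(1 - w) <= 1 finishes.
    The bounds 1/4 keep the radicands positive. *)
Lemma fibre_width (R : realType) (e w : R) : 0 < e <= 1 / 4 -> 0 <= w <= 1 / 4 ->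
  e *+ 2 * (1 + w) <=
    Num.sqrt ((1 + e) ^+ 2 - w *+ 2) - Num.sqrt ((1 - e) ^+ 2 - w *+ 2).
Proof.
move=> /andP[e0 e1] /andP[w0 w1].
have sqrt_le (y : R) : 3 / 4 <= y -> Num.sqrt (y ^+ 2 - w *+ 2) <= y - w / y.
  move=> y1; have y0 : 0 < y by lra.
  have wy : w / y <= y by rewrite ler_pdivrMr//; nra.
  rewrite -[leRHS]ger0_norm ?subr_ge0// -sqrtr_sqr ler_wsqrtr//.
  have -> : (y - w / y) ^+ 2 = y ^+ 2 - w *+ 2 + (w / y) ^+ 2.
    by field; rewrite gt_eqF.
  by rewrite lerDl sqr_ge0.
have pos : (1 - e) ^+ 2 - w *+ 2 > 0 by nra.
have pos' : (1 + e) ^+ 2 - w *+ 2 > 0 by nra.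
have hA := sqrt_le (1 + e); have hB := sqrt_le (1 - e).
have Ap := sqr_sqrtr (ltW pos'); have Bp := sqr_sqrtr (ltW pos).
have A0 : 0 <= Num.sqrt ((1 + e) ^+ 2 - w *+ 2) by exact: sqrtr_ge0.
have B0 : 0 < Num.sqrt ((1 - e) ^+ 2 - w *+ 2) by rewrite sqrtr_gt0.
set A := Num.sqrt ((1 + e) ^+ 2 - _) in Ap A0 hA *.
set B := Num.sqrt ((1 - e) ^+ 2 - _) in Bp B0 hB *.
have AB : A + B <= 2 - w *+ 2.
  apply: (@le_trans _ _ ((1 + e - w / (1 + e)) + (1 - e - w / (1 - e)))).
    by apply: lerD; [apply: hA|apply: hB]; lra.
  suff : w *+ 2 <= w / (1 + e) + w / (1 - e) by lra.
  rewrite -mulr_natr -mulrDr ler_wpM2l//.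
  have -> : (1 + e)^-1 + (1 - e)^-1 = 2 / (1 - e ^+ 2).
    by field; apply/and3P; split; apply/eqP; nra.
  by rewrite ler_pdivlMr; nra.
have AB4 : (A - B) * (A + B) = 4 * e.
  by rewrite -subr_sqr Ap Bp; ring.
rewrite leNgt; apply/negP => lt.
have : (A - B) * (A + B) < e *+ 2 * (1 + w) * (2 - w *+ 2).
  apply: (@lt_le_trans _ _ (e *+ 2 * (1 + w) * (A + B))).
    by rewrite ltr_pM2r//; lra.
  by rewrite ler_wpM2l// mulr_ge0//; lra.
have : 0 <= e * w ^+ 2 by rewrite mulr_ge0 ?sqr_ge0// ltW.
by rewrite AB4; lra.
Qed.

(** * One step under a potential [W], near the axis: the same section serves [W] zero and [W] a
    bump *)

Section Dynamics.
Context {R : realType} {n : nat}.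
Local Notation E := (phase R n).
Local Notation C := ('I_n + 'I_n)%type.
Implicit Types (x y : E) (A O U : set E) (c : C).

Definition axis_point (i : 'I_n) (s : R) : E :=
  of_coord (upd (fun c : C => (c == inr i)%:R) (inl i : C) s).

Lemma axis_point_line (i : 'I_n) (s : R) : axis_line i (axis_point i s).
Proof.
exists s; apply: coord_inj => c; rewrite coord_of_coord /upd.
case: c => k /=; rewrite !mxE eqxx/=.
  rewrite -[inl k == inl i]/(k == i); case: (k == i); rewrite ?mulr1// mulr0.
  by [].
by [].
Qed.

Lemma continuous_line (g : C -> R) (c0 : C) :
  continuous (fun s : R => of_coord (upd g c0 s) : E).
Proof.
move=> s O /nbhs_coord[e e0 eO].
change (\forall t \near s, O (of_coord (upd g c0 t))); near=> t; apply: eO => c.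
rewrite !coord_of_coord /upd; case: (c == c0); last by rewrite subrr normr0.
rewrite distrC; near: t; exact: nbhsx_ballx.
Unshelve. all: by end_near. Qed.

Context (i : 'I_n) (W : R -> R) (U : set E) (Psi : E -> E).
Local Notation ax := (axis_point i).
Local Notation q x := (coord (inl i) x).
Local Notation p x := (coord (inr i) x).

Hypothesis openU : open U.
Hypothesis axisU : axis_line i `<=` U.
Hypothesis Psi_cont : forall x, U x -> {for x, continuous Psi}.
Hypothesis Psi_vol : volume_conserving_on U Psi.
Hypothesis Psi_energy : forall x, U x ->
  p (Psi x) ^+ 2 / 2 + W (q (Psi x)) = p x ^+ 2 / 2 + W (q x).
Hypothesis Psi_rest : forall x c, U x -> c != inl i -> c != inr i ->
  coord c (Psi x) = coord c x.
Hypothesis W_bound : forall t, 0 <= W t <= 1 / 4.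

Lemma q_axis s : q (ax s) = s.
Proof. by rewrite coord_of_coord /upd eqxx. Qed.

Lemma p_axis s : p (ax s) = 1.
Proof. by rewrite coord_of_coord /upd eqxx. Qed.

Lemma U_axis s : U (ax s).
Proof. by apply: axisU; exact: axis_point_line. Qed.

Lemma Psi_coord_cont c x : U x -> {for x, continuous (coord c \o Psi)}.
Proof.
by move=> Ux; apply: continuous_comp; [exact: Psi_cont|exact: continuous_coord].
Qed.

Lemma Psi_line_cont c (g : C -> R) (a b : R) :
  (forall s, a <= s <= b -> U (of_coord (upd g (inl i : C) s))) ->
  {within `[a, b], continuous
    (fun s => coord c (Psi (of_coord (upd g (inl i : C) s))))}.
Proof.
move=> gU; apply: continuous_in_subspaceT => s; rewrite inE/= in_itv/= => /gU sU.
apply: (continuous_comp (f := fun s => of_coord (upd g (inl i : C) s))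
  (g := coord c \o Psi)); first exact: continuous_line.
exact: Psi_coord_cont.
Qed.

(** At a zero of the momentum the potential alone would carry an energy of at least 1/2, but it is
    at most 1/4. *)
Lemma momentum_gt0 (a b : R) : 0 < p (Psi (ax a)) ->
  forall s, a <= s <= b -> 0 < p (Psi (ax s)).
Proof.
move=> pa s /andP[a_s sb]; rewrite ltNge; apply/negP => ps.
have [||r _] := @IVT R (fun s => p (Psi (ax s))) a s 0 a_s.
- by apply: Psi_line_cont => r _; exact: U_axis.
- by rewrite ge_min le_max ps (ltW pa) orbT.
move=> pr; have := Psi_energy (U_axis r).
rewrite pr p_axis q_axis; have := W_bound r.
by have := W_bound (q (Psi (ax r))); lra.
Qed.

Let g0 (c : C) : R := (c == inr i)%:R.

Definition tube (s t e : R) : E * E :=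
  (of_coord (upd (fun c => g0 c - e) (inl i : C) s),
   of_coord (upd (fun c => g0 c + e) (inl i : C) t)).

Lemma in_tube s t e x : open_box (tube s t e) x <->
  s < q x < t /\ forall c, c != inl i -> `|coord c x - g0 c| < e.
Proof.
split=> [xe|[qx xe] c].
  split=> [|c ci]; first by have := xe (inl i); rewrite !coord_of_coord /upd eqxx.
  have := xe c; rewrite !coord_of_coord /upd (negbTE ci).
  by rewrite ltr_distl.
rewrite !coord_of_coord /upd; have [->//|ci] := eqVneq c (inl i).
by rewrite -ltr_distl; exact: xe.
Qed.

Let others (e : R) : R := \prod_(c | (c != inl i) && (c != inr i)) (e *+ 2).

Lemma others_gt0 e : 0 < e -> 0 < others e.
Proof. by move=> e0; apply: prodr_gt0 => c _; rewrite pmulrn_lgt0. Qed.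

Lemma tube_volume s t e : box_volume (tube s t e) = (t - s) * (e *+ 2) * others e.
Proof.
rewrite /box_volume (bigD1 (inl i)) // (bigD1 (inr i)) // -mulrA.
congr (_ * (_ * _)).
- by rewrite !coord_of_coord /upd eqxx.
- by rewrite !coord_of_coord /upd/= mulr2n; ring.
apply: eq_bigr => c /andP[/negbTE ci _].
by rewrite !coord_of_coord /upd ci mulr2n; ring.
Qed.

Lemma volume_tube_le s t e A : s <= t -> 0 < e -> A `<=` open_box (tube s t e) ->
  (vol A <= ((t - s) * (e *+ 2) * others e)%:E)%E.
Proof.
move=> st e0 Ae; rewrite -tube_volume; apply: vol_open_box_le => //.
  exact: leq_ltn_trans (ltn_ord i).
move=> c; rewrite !coord_of_coord /upd; case: ifP => _ //.
by lra.
Qed.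

(** The thin tube over []s, t[] has volume proportional to [t - s]. Its image contains the energy
    shells over nearly all of the interval between [f s] and [f t], and these are wider by the
    factor [1 + v] over []j, k[]. For [v = 0] the lemma says that f is 1-Lipschitz. *)
Lemma stretch_le (s t j k v : R) :
  let f r := q (Psi (ax r)) in
  s < t -> (forall r, s <= r <= t -> W r = 0) -> 0 < p (Psi (ax s)) ->
  0 <= v -> (forall r, j < r < k -> v <= W r) ->
  Num.min (f s) (f t) < j -> j <= k -> k < Num.max (f s) (f t) ->
  `|f t - f s| + v * (k - j) <= t - s.
Proof.
move=> f st W0 ps v0 vW; set a := Num.min _ _; set b := Num.max _ _ => aj jk kb.
have [ba fab] : `|f t - f s| = b - a /\
    ((a = f s /\ b = f t) \/ (a = f t /\ b = f s)).
  rewrite /a /b; case: (leP (f s) (f t)) => fst.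
    by split; [rewrite ger0_norm ?subr_ge0|left].
  by split; [rewrite distrC ger0_norm// subr_ge0 ltW|right].
rewrite ba leNgt; apply/negP => lt.
pose D := b - a + v * (k - j) - (t - s).
have D0 : 0 < D by rewrite /D; lra.
(* The shells are only shown to be filled up to [d] from either end: [D / 4] makes the loss [2 * d]
   smaller than the excess [D], and the other two bounds keep []j, k[] inside the filled part. *)
pose d := Num.min (D / 4) (Num.min (j - a) (b - k)).
have d0 : 0 < d by rewrite /d !lt_min divr_gt0//= !subr_gt0 aj.
have [dD [dj dk]] : d <= D / 4 /\ d <= j - a /\ d <= b - k.
  by rewrite /d !ge_min !lexx !orbT.
pose O := [set x | U x /\ 0 < p (Psi x)].
have [e1 e10 tubeO] : exists2 e0 : R, 0 < e0 & forall e y, e <= e0 ->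
    s <= q y <= t -> (forall c, c != inl i -> `|coord c y - g0 c| < e) -> O y.
  apply: tube_nbhs => r rst; apply: filterI.
    by apply: open_nbhs_nbhs; split => //; exact: U_axis.
  have /cvgr_gt := Psi_coord_cont (c := inr i) (U_axis r).
  by apply; exact: momentum_gt0 ps r rst.
have near_end r : exists2 e : R, 0 < e & forall y,
    (forall c, `|coord c y - coord c (ax r)| < e) -> `|f r - q (Psi y)| < d.
  apply: nbhs_coord.
  have /cvgrPdist_lt/(_ d d0) := Psi_coord_cont (c := inl i) (U_axis r).
  exact.
have [e2 e20 nears] := near_end s; have [e3 e30 neart] := near_end t.
pose e := Num.min (1 / 4) (Num.min e1 (Num.min e2 e3)).
have e0 : 0 < e by rewrite /e !lt_min e10 e20 e30 !andbT; lra.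
have [e4 [ee1 [ee2 ee3]]] : e <= 1 / 4 /\ e <= e1 /\ e <= e2 /\ e <= e3.
  by rewrite /e !ge_min !lexx !orbT.
pose A := open_box (tube s t e).
have AO : A `<=` O.
  move=> x /in_tube[/andP[/ltW sx /ltW xt] xe].
  by apply: (tubeO e) => //; apply/andP.
have volA : (vol (Psi @` A) <= ((t - s) * (e *+ 2) * others e)%:E)%E.
  rewrite Psi_vol//.
  - by apply: volume_tube_le; rewrite ?ltW.
  - exact: open_open_box.
  - exact: bounded_open_box.
  - by move=> x /AO[].
suff : ((((e *+ 2) * ((b - d) - (a + d)) + (e *+ 2 * v) * (k - j)) * others e)%:E
    <= vol (Psi @` A))%E.
  move=> /le_trans/(_ volA); rewrite lee_fin ler_pM2r ?others_gt0//.
  rewrite [(t - s) * _]mulrC -mulrA -mulrDr ler_pM2l ?pmulrn_lgt0//.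
  by rewrite /D in dD D0; lra.
have -> : others e = \prod_(c | (c != inl i) && (c != inr i))
    ((g0 c + e) - (g0 c - e)).
  by apply: eq_bigr => c _; ring.
apply: (@vol_ge_fibred _ _ (Psi @` A) i (fun c => g0 c - e) (fun c => g0 c + e)
  (fun z => Num.sqrt ((1 - e) ^+ 2 - W z *+ 2))
  (fun z => Num.sqrt ((1 + e) ^+ 2 - W z *+ 2))
  (a + d) (b - d) j k (e *+ 2) (e *+ 2 * v)) => //.
- by lra.
- by rewrite mulrn_wge0// ltW.
- by rewrite mulr_ge0// mulrn_wge0// ltW.
- by move=> c; lra.
- by move=> y _; apply: ler_wsqrtr; lra.
- move=> y _; apply: le_trans (fibre_width _ (W_bound y)); last by rewrite e0.
  by rewrite ler_peMr ?mulrn_wge0 ?(ltW e0)//; have := W_bound y; lra.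
- move=> y jyk; split; first by lra.
  apply: le_trans (fibre_width _ (W_bound y)); last by rewrite e0.
  by rewrite mulrDr mulr1 lerD2l ler_wpM2l ?mulrn_wge0 ?(ltW e0)// vW.
move=> y; set w := W (q y) => qy py yrest.
have /andP[w0 w1] : 0 <= w <= 1 / 4 := W_bound _.
have py0 : 0 < p y by apply: le_lt_trans (sqrtr_ge0 _) (andP py).1.
have py2 : (1 - e) ^+ 2 < p y ^+ 2 + w *+ 2 < (1 + e) ^+ 2.
  have pyE : p y = Num.sqrt (p y ^+ 2) by rewrite sqrtr_sqr gtr0_norm.
  have /andP[] := py; rewrite pyE !ltr_sqrt; last 2 first.
  - by nra.
  - by rewrite exprn_gt0.
  by rewrite -pyE => l u; apply/andP; split; lra.
(* A preimage of [y] is sought on the line with the idle coordinates of [y] and momentum [p1], the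
   one that has the energy of [y] where the potential is zero. The right [q] is found by continuity;
   energy then gives the square of the momentum, and positivity its sign. *)
pose p1 := Num.sqrt (p y ^+ 2 + w *+ 2).
have p1y : p1 ^+ 2 = p y ^+ 2 + w *+ 2 by rewrite sqr_sqrtr//; nra.
have p10 : 0 <= p1 := sqrtr_ge0 _.
have p1e : `|p1 - 1| < e.
  by rewrite -p1y in py2; have [] := andP py2; rewrite ltr_norml; nra.
pose line r := of_coord (upd (upd (coord^~ y) (inr i : C) p1) (inl i : C) r).
have line_q r : q (line r) = r by rewrite coord_of_coord /upd eqxx.
have line_p r : p (line r) = p1 by rewrite coord_of_coord /upd/= eqxx.
have line_e r c : c != inl i -> `|coord c (line r) - g0 c| < e.
  move=> ci; have [->|ci'] := eqVneq c (inr i).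
    by rewrite line_p /g0 eqxx.
  rewrite coord_of_coord /upd (negbTE ci) (negbTE ci').
  by rewrite ltr_distl yrest.
have line_near r c : `|coord c (line r) - coord c (ax r)| < e.
  have [->|ci] := eqVneq c (inl i); first by rewrite line_q q_axis subrr normr0.
  by have := line_e r c ci; rewrite [coord c (ax r)]coord_of_coord /upd (negbTE ci).
have line_O r : s <= r <= t -> O (line r).
  by move=> rst; apply: (tubeO e); rewrite ?line_q//; exact: line_e.
have fs : `|f s - q (Psi (line s))| < d.
  by apply: nears => c; exact: lt_le_trans (line_near s c) ee2.
have ft : `|f t - q (Psi (line t))| < d.
  by apply: neart => c; exact: lt_le_trans (line_near t c) ee3.
have [||r rst qr] := @IVT R (fun r => q (Psi (line r))) s t (q y) (ltW st).
- by apply: Psi_line_cont => r /line_O[].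
- rewrite ge_min le_max; case: fab => -[ea eb];
    rewrite ltr_distl in fs; rewrite ltr_distl in ft;
    apply/andP; split; apply/orP; by [left; lra|right; lra].
have {}qr : q (Psi (line r)) = q y := qr.
(* The tube is open, so its end faces must be excluded: they land within [d] of [f s] and [f t],
   whereas [q y] stays further away. *)
have rs : r != s.
  apply/eqP => rs; rewrite rs in qr; rewrite qr ltr_distl in fs.
  by case: fab => -[ea eb]; lra.
have rt : r != t.
  apply/eqP => rt; rewrite rt in qr; rewrite qr ltr_distl in ft.
  by case: fab => -[ea eb]; lra.
move: rst; rewrite in_itv/= => rst; have [Ur pr] := line_O r rst.
exists (line r).
  apply/in_tube; split; last exact: line_e.
  by rewrite line_q !lt_neqAle eq_sym rs rt.
apply: coord_inj => c; have [->//|ci] := eqVneq c (inl i).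
have [->|ci'] := eqVneq c (inr i).
  have := Psi_energy Ur; rewrite qr line_p line_q (W0 r rst) p1y -/w => en.
  by apply/eqP; rewrite -(eqrXn2 (n:=2)) ?ltW//; apply/eqP; lra.
by rewrite Psi_rest// coord_of_coord /upd (negbTE ci) (negbTE ci').
Qed.

(** Without potential the step preserves the positive momentum, so the image of a thin tube lies in
    a tube of the same radius over the range of f. Conservation of volume then makes this range at
    least as long as [[a, b]]. *)
Lemma free_shift_ge (a b : R) :
  let f r := q (Psi (ax r)) in
  a < b -> (forall t, W t = 0) -> 0 < p (Psi (ax a)) -> f a < f b ->
  b - a <= f b - f a.
Proof.
move=> f ab W0 pa fab.
(* The case [v = 0] of [stretch_le], with [j = k] placed at the midpoint merely to lie strictly
   between the two values. *)
have lip s t : a <= s -> s < t -> t <= b -> `|f t - f s| <= t - s.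
  move=> sa st tb; have ps : 0 < p (Psi (ax s)).
    by apply: (momentum_gt0 pa (s := s) (b := b)); rewrite sa ltW// (lt_le_trans st).
  have [fst|fst|->] := ltgtP (f s) (f t); last by rewrite subrr normr0 subr_ge0 ltW.
    have := @stretch_le s t ((f s + f t) / 2) ((f s + f t) / 2) 0 st.
    rewrite subrr mulr0 addr0 -/(f s) -/(f t) (min_l (ltW fst)) (max_r (ltW fst)).
    by apply => //; [move=> r _; rewrite W0|lra..].
  have := @stretch_le s t ((f s + f t) / 2) ((f s + f t) / 2) 0 st.
  rewrite subrr mulr0 addr0 -/(f s) -/(f t) (min_r (ltW fst)) (max_l (ltW fst)).
  by apply => //; [move=> r _; rewrite W0|lra..].
have fcont : {within `[a, b], continuous f}.
  by apply: Psi_line_cont => r _; exact: U_axis.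
have [s sab fs] := EVT_max (ltW ab) fcont; have [t tab ft] := EVT_min (ltW ab) fcont.
move: sab tab; rewrite !in_itv/= => /andP[sa sb] /andP[ta tb].
(* A 1-Lipschitz f with so large an oscillation attains its extrema at the two ends, and [f a < f b]
   tells which is which. *)
suff osc : b - a <= f s - f t.
  have := fs b; have := ft a; rewrite !in_itv/= !lexx (ltW ab) => /(_ isT) fta /(_ isT) fbs.
  have [st|ts|st] := ltgtP s t; last by rewrite st in osc; lra.
    have := lip s t sa st tb; rewrite ler_norml => /andP[+ _] => stl.
    have [sa' tb'] : s = a /\ t = b by split; lra.
    by rewrite sa' tb' in osc; lra.
  have := lip t s ta ts sb; rewrite ler_norml => /andP[_ +] => tsl.
  have [ta' sb'] : t = a /\ s = b by split; lra.
  by rewrite ta' sb' in osc.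
rewrite leNgt; apply/negP => lt.
have tfs : f t <= f s by apply: fs; rewrite in_itv/= ta.
(* The enclosing tube exceeds the range of f by [d] at each end, so half of the missing length
   remains for the contradiction. *)
pose d := (b - a - (f s - f t)) / 4; have d0 : 0 < d by rewrite /d; lra.
pose O := [set x | U x /\ (f t - d < q (Psi x) < f s + d /\ 0 < p (Psi x))].
have [e1 e10 tubeO] : exists2 e0 : R, 0 < e0 & forall e y, e <= e0 ->
    a <= q y <= b -> (forall c, c != inl i -> `|coord c y - g0 c| < e) -> O y.
  apply: tube_nbhs => r rab; apply: filterI.
    by apply: open_nbhs_nbhs; split => //; exact: U_axis.
  apply: filterI.
    have qc := Psi_coord_cont (c := inl i) (U_axis r).
    have fr : f t - d < f r /\ f r < f s + d.
      have := fs r; have := ft r; rewrite in_itv/= rab => /(_ isT) ? /(_ isT) ?.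
      by split; lra.
    have /cvgr_gt/(_ _ fr.1) := qc; have /cvgr_lt/(_ _ fr.2) := qc.
    by apply: filterS2 => z /= h1 h2; apply/andP.
  have /cvgr_gt := Psi_coord_cont (c := inr i) (U_axis r).
  by apply; exact: momentum_gt0 pa r rab.
pose e := Num.min (1 / 2) e1.
have e0 : 0 < e by rewrite /e lt_min e10 andbT; lra.
have [e12 ee1] : e <= 1 / 2 /\ e <= e1 by rewrite /e !ge_min !lexx !orbT.
pose A := open_box (tube a b e).
have AO : A `<=` O.
  move=> x /in_tube[/andP[/ltW ax /ltW xb] xe].
  by apply: (tubeO e) => //; apply/andP.
have volA : ((e *+ 2 * (b - a) * others e)%:E <= vol A)%E.
  have -> : e *+ 2 * (b - a) * others e =
      (e *+ 2 * (b - a) + 0 * (a - a)) *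
        \prod_(c | (c != inl i) && (c != inr i)) ((g0 c + e) - (g0 c - e)).
    by congr (_ * _); [ring|apply: eq_bigr => c _; ring].
  apply: (@vol_ge_fibred _ _ A i (fun c => g0 c - e) (fun c => g0 c + e)
    (fun=> 1 - e) (fun=> 1 + e)) => //.
  - exact: ltW.
  - by rewrite mulrn_wge0// ltW.
  - by move=> c; lra.
  - by move=> _ _; lra.
  - by move=> _ _; rewrite mulr2n; lra.
  - by move=> r /andP[/lt_trans/[apply]]; rewrite ltxx.
  move=> x qx px xe; apply/in_tube; split => // c ci; rewrite ltr_distl.
  have [->|ci'] := eqVneq c (inr i); last exact: xe.
  by rewrite /g0 eqxx.
have volPA : (vol (Psi @` A) <=
    ((f s + d - (f t - d)) * (e *+ 2) * others e)%:E)%E.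
  apply: volume_tube_le => //; first by lra.
  move=> _ [x Ax <-]; have [Ux [qx px]] := AO _ Ax.
  have [_ xe] := (in_tube _ _ _ _).1 Ax.
  apply/in_tube; split => // c ci.
  have [ci'|ci'] := eqVneq c (inr i); last by rewrite Psi_rest//; exact: xe.
  suff -> : coord c (Psi x) = coord c x by exact: xe.
  have := xe c ci; rewrite ci' /g0 eqxx mulr1n ltr_norml => /andP[xe1 xe2].
  apply/eqP; rewrite -(eqrXn2 (n := 2)) ?(ltW px)//; last by lra.
  by have := Psi_energy Ux; rewrite !W0 => en; apply/eqP; lra.
have := le_trans volA; rewrite -(Psi_vol (A := A)); last first.
- by move=> x /AO[].
- exact: bounded_open_box.
- exact: open_open_box.
move=> /(_ _ volPA); rewrite lee_fin ler_pM2r ?others_gt0//.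
rewrite mulrC ler_pM2r ?pmulrn_lgt0// /d; lra.
Qed.

End Dynamics.

(** * Infinitely derivable functions and bumps *)

Section InfinitelyDerivable.
Context {R : realType}.
Implicit Types (f g V : R -> R) (P : {poly R}).

Definition cinfty f := forall (k : nat) (t : R), derivable (derive1n k f) t 1.

Lemma derive1nSr f k : derive1n k (derive1 f) = derive1n k.+1 f.
Proof. by rewrite /derive1n -iterSr. Qed.

(** Avoids formulas for higher derivatives: a class that contains the function and is stable under
    derivation is enough. *)
Lemma cinfty_coind (K : (R -> R) -> Prop) :
  (forall f, K f -> exists2 g, K g & forall t : R, is_derive t 1 f (g t)) ->
  forall f, K f -> cinfty f.
Proof.
move=> step f Kf k; elim: k f Kf => [|k IH] f /step[g Kg fg] t //.
rewrite -derive1nSr (_ : derive1 f = g); first exact: IH.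
by apply/funext => s; rewrite derive1E; have [_ ->] := fg s.
Qed.

Lemma cinfty_derive1 f : cinfty f -> cinfty (derive1 f).
Proof. by move=> Cf k t; rewrite derive1nSr; exact: Cf. Qed.

Lemma cinfty_is_derive f (t : R) : cinfty f -> is_derive t 1 f (derive1 f t).
Proof. by move=> Cf; rewrite derive1E; apply/derivableP; exact: (Cf 0%N). Qed.

Lemma cinfty_continuous f : cinfty f -> continuous f.
Proof.
by move=> Cf t; apply/differentiable_continuous/derivable1_diffP; exact: (Cf 0%N).
Qed.

Lemma cinfty_horner P : cinfty (horner P).
Proof.
apply: (@cinfty_coind (fun f => exists P, f = horner P)); last by exists P.
move=> _ [Q ->]; exists (horner (deriv Q)); first by exists (deriv Q).
by move=> t; exact: is_derive_poly.
Qed.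

Lemma cinftyZ (a : R) f : cinfty f -> cinfty (fun t => a * f t).
Proof.
move=> Cf.
apply: (@cinfty_coind (fun g => exists2 f, cinfty f & g = (fun t => a * f t)));
  last by exists f.
move=> _ [g Cg ->]; exists (fun t => a * derive1 g t).
  by exists (derive1 g) => //; exact: cinfty_derive1.
move=> t; have Dg := cinfty_is_derive t Cg; exact: is_deriveZ.
Qed.

(* The derivatives of exp(-1/y), extended by 0 to y <= 0, are of this form. *)
Definition expflat P (y : R) := if 0 < y then P.[y^-1] * expR (- y^-1) else 0.

Lemma horner_growth P : exists C N, forall t : R, 1 <= t -> `|P.[t]| <= C * t ^+ N.
Proof.
elim/poly_ind: P => [|P c [C [N PCN]]].
  by exists 0, 0%N => t _; rewrite horner0 normr0 mul0r.
exists (C + `|c|), N.+1 => t t1; rewrite hornerMXaddC (le_trans (ler_normD _ _))//.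
rewrite mulrDl lerD//.
  by rewrite normrM exprSr mulrA (@ger0_norm _ t) ?ler_pM// ?PCN// (le_trans ler01).
by rewrite ler_peMr// exprn_ege1.
Qed.

(** If P grows like t^N, the exponential series gives exp(1/y) >= y^-(N+1) / (N+1)!, one power more
    than P(1/y), which leaves a factor y. *)
Lemma expflat_le P : exists C, forall y, `|y| < 1 -> `|expflat P y| <= C * `|y|.
Proof.
have [C [N PCN]] := horner_growth P.
exists (C * N.+1`!%:R) => y y1; rewrite /expflat.
have C0 : 0 <= C by have := PCN 1 (lexx _); rewrite expr1n mulr1; exact: le_trans.
case: ifPn => [y0|_]; last by rewrite normr0 !mulr_ge0.
move: y1; rewrite gtr0_norm// => y1.
have y1' : 1 <= y^-1 by rewrite invf_ge1// ltW.
rewrite normrM (gtr0_norm (expR_gt0 _)) expRN.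
apply: (@le_trans _ _ (C * y^-1 ^+ N * (y^-1 ^+ N.+1 / N.+1`!%:R)^-1)).
  rewrite ler_pM ?invr_ge0 ?expR_ge0 ?PCN// lef_pV2 ?posrE ?expR_gt0//.
    apply: le_trans (expR_ge1Dxn N _); last by rewrite invr_ge0 ltW.
    by rewrite lerDr.
  by rewrite divr_gt0// exprn_gt0// invr_gt0.
rewrite invf_div exprSr invfM invrK -!mulrA ler_wpM2l//.
rewrite mulrCA ler_wpM2l// mulrA mulfV ?mul1r// expf_neq0//.
by rewrite invr_neq0// gt_eqF.
Qed.

Lemma is_derive_expflat P (y : R) :
  is_derive y 1 (expflat P) (expflat ('X^2 * (P - deriv P)) y).
Proof.
have [y0|y0|->] := ltgtP y 0.
- rewrite [X in is_derive _ _ _ X](_ : _ = 0); last first.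
    by rewrite /expflat ltNge (ltW y0).
  apply: (@near_eq_is_derive _ _ _ (cst 0)).
  near=> z; rewrite /expflat ltNge (_ : z <= 0)//.
  by apply: ltW; near: z; exact: lt_nbhsl.
- have Dinv : is_derive y 1 (fun z : R => z^-1) (- y ^- 2).
    by rewrite -[- _]mulr1; apply: is_deriveV; rewrite gt_eqF.
  have DP := is_derive1_comp (is_derive_poly P y^-1) Dinv.
  have DN : is_derive y 1 (fun z : R => - z^-1) (- - y ^- 2) := is_deriveN Dinv.
  have De := @is_derive1_comp _ expR (fun z => - z^-1) y _ _
    (is_derive_expR (- y^-1)) DN.
  have := is_deriveM DP De.
  rewrite [X in is_derive _ _ _ X -> _](_ : _ =
      expflat ('X^2 * (P - deriv P)) y); last first.
    rewrite /expflat y0 !hornerE /= /GRing.scale /=.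
    by field; rewrite gt_eqF.
  apply: near_eq_is_derive; near=> z; rewrite /expflat (_ : 0 < z)//.
  by near: z; exact: lt_nbhsr.
- rewrite [X in is_derive _ _ _ X](_ : _ = 0); last by rewrite /expflat ltxx.
  (* The difference quotient of [expflat P] at 0 is [expflat ('X * P)], so the linear bound sends it
     to 0. *)
  have [C PC] := expflat_le ('X * P).
  have cvg0 : h^-1 *: (expflat P (h *: 1 + 0) - expflat P 0) @[h --> 0^'] --> 0.
    apply/cvgrPdist_lt => e e0; near=> h.
    have h0 : h != 0 by near: h; exact: nbhs_dnbhs_neq.
    have -> : h^-1 *: (expflat P (h *: 1 + 0) - expflat P 0) = expflat ('X * P) h.
      rewrite [_ *: 1]mulr1 addr0 /expflat ltxx subr0 hornerM hornerX.
      by case: ifP => _; [rewrite [_ *: _]mulrA|rewrite scaler0].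
    rewrite sub0r normrN.
    have hd : `|h| < Num.min 1 (e / (`|C| + 1)).
      near: h; apply: dnbhs0_lt.
      by rewrite lt_min ltr01 divr_gt0// ltr_wpDl.
    move: hd; rewrite lt_min => /andP[h1 he].
    apply: le_lt_trans (PC h h1) _; move: he.
    rewrite ltr_pdivlMr ?ltr_wpDl// mulrC; apply: le_lt_trans.
    by rewrite ler_wpM2r// (le_trans (ler_norm C))// lerDl.
  apply: DeriveDef; first by apply/cvg_ex; exists 0.
  exact: cvg_lim.
Unshelve. all: by end_near. Qed.

(** A class made for [cinfty_coind]: by the Leibniz rule the derivative of such a product is a sum
    of two, the sign from [v - t] being absorbed in the polynomial. *)
Inductive bump_algebra (u v : R) : (R -> R) -> Prop :=
| bump_prod P Q :
    bump_algebra u v (fun t => expflat P (t - u) * expflat Q (v - t))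
| bump_add f g : bump_algebra u v f -> bump_algebra u v g ->
    bump_algebra u v (f + g).

Lemma expflatN P (y : R) : expflat (- P) y = - expflat P y.
Proof. by rewrite /expflat; case: ifP => _; rewrite ?oppr0// hornerN mulNr. Qed.

Lemma cinfty_bump (u v : R) f : bump_algebra u v f -> cinfty f.
Proof.
apply: cinfty_coind => {}f; elim=> [P Q|f1 f2 _ [g1 K1 D1] _ [g2 K2 D2]].
  pose P' := 'X^2 * (P - deriv P); pose Q' := - ('X^2 * (Q - deriv Q)).
  exists ((fun t => expflat P' (t - u) * expflat Q (v - t)) +
          (fun t => expflat P (t - u) * expflat Q' (v - t))).
    by apply: bump_add; exact: bump_prod.
  move=> t.
  have Du : is_derive t 1 (fun s : R => s - u) 1.
    by rewrite -[X in is_derive _ _ _ X]subr0; exact: is_deriveB.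
  have Dv : is_derive t 1 (fun s : R => v - s) (- 1).
    by rewrite -[X in is_derive _ _ _ X]sub0r; exact: is_deriveB.
  have DP := @is_derive1_comp _ (expflat P) (fun s => s - u) t _ _
    (is_derive_expflat P (t - u)) Du.
  have DQ := @is_derive1_comp _ (expflat Q) (fun s => v - s) t _ _
    (is_derive_expflat Q (v - t)) Dv.
  apply: (is_derive_eq (is_deriveM DP DQ)).
  by rewrite /GRing.scale/= -/P' !fctE /= expflatN; ring.
exists (g1 + g2); first exact: bump_add.
by move=> t; have D1t := D1 t; have D2t := D2 t; exact: is_deriveD.
Qed.

Lemma bump_exists (u v : R) : u < v -> exists V : R -> R,
  [/\ test_function V, forall t, 0 <= V t <= 1 / 4,
      forall t, ~~ (u < t < v) -> V t = 0 & 0 < V ((u + v) / 2)].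
Proof.
move=> uv; have e01 (y : R) : 0 <= expflat 1 y <= 1.
  rewrite /expflat; case: ifP => y0; last by rewrite lexx ler01.
  by rewrite hornerC mul1r expR_ge0/= expR_le1 oppr_le0 invr_ge0 ltW.
have e0 (y : R) : 0 < y -> 0 < expflat 1 y.
  by move=> y0; rewrite /expflat y0 hornerC mul1r expR_gt0.
(* Both exponential factors are at most 1, so 1/4 yields the bound required of potentials in the
   volume comparison. *)
pose V t := 1 / 4 * (expflat 1 (t - u) * expflat 1 (v - t)).
have V0 t : ~~ (u < t < v) -> V t = 0.
  rewrite negb_and -!leNgt /V => /orP[tu|vt].
    by rewrite {1}/expflat ltNge subr_le0 tu mul0r mulr0.
  by rewrite {2}/expflat ltNge subr_le0 vt mulr0 mulr0.
exists V; split => //.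
- split; first by apply: cinftyZ; apply: cinfty_bump; exact: bump_prod.
  apply: (subclosed_compact (B := `[u, v]%classic)).
  + exact: closed_closure.
  + exact: segment_compact.
  + have /closure_id -> : closed `[u, v]%classic by exact: interval_closed.
    apply: closure_subset => t /= Vt; rewrite in_itv/=.
    apply: contraNT Vt => tuv; rewrite V0//.
    by apply: contra tuv => /andP[/ltW -> /ltW ->].
- move=> t; rewrite /V; have /andP[a0 a1] := e01 (t - u).
  by have /andP[b0 b1] := e01 (v - t); apply/andP; split; nra.
- by rewrite /V !mulr_gt0// ?e0//; lra.
Qed.

End InfinitelyDerivable.

(** * Smoothness and locality of Hamiltonians with a potential *)

Section Smoothness.
Context {R : realType} {n : nat}.
Local Notation E := (phase R n).
Local Notation C := ('I_n + 'I_n)%type.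
Implicit Types (x y : E) (f g : E -> R) (c : C).

(* Each partial derivative of a function of this form has again this form. *)
Definition separable (i : 'I_n) (T W : R -> R) : E -> R :=
  fun x => T (coord (inr i) x) + W (coord (inl i) x).

(** The difference quotients coincide as functions of the increment, so existence and value of the
    derivative transfer together. *)
Lemma is_derive_along f x (v : E) (h : R -> R) (a d : R) :
  (forall s : R, f (s *: v + x) - f x = h (s *: 1 + a) - h a) ->
  is_derive a 1 h d -> is_derive x v f d.
Proof.
move=> fh [Dh dE].
have quotE : (fun s : R => s^-1 *: ((f \o shift x) (s *: v) - f x)) =
    (fun s : R => s^-1 *: ((h \o shift a) (s *: 1) - h a)).
  by apply/funext => s /=; rewrite fh.
by apply: DeriveDef; rewrite /derivable /derive quotE.
Qed.

Lemma coord_basis c c' (s : R) x :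
  coord c (s *: basis_vec c' + x) = s * (c == c')%:R + coord c x.
Proof.
by case: c c' => k [] l; rewrite /= !mxE ?eqxx ?mulr0//= eq_sym.
Qed.

Lemma is_derive_separable (i : 'I_n) (T W : R -> R) x c :
  cinfty T -> cinfty W ->
  is_derive x (basis_vec c) (separable i T W) (separable i
    (if c == inr i then derive1 T else cst 0)
    (if c == inl i then derive1 W else cst 0) x).
Proof.
move=> CT CW; rewrite /separable.
have [->|ci] := eqVneq c (inr i).
  rewrite addr0; apply: (is_derive_along (h := T) (a := coord (inr i) x)).
    move=> s; rewrite !coord_basis eqxx mulr1 [_ == _]/= mulr0 add0r.
    by rewrite [s *: _]mulr1; ring.
  exact: cinfty_is_derive.
have [->|ci'] := eqVneq c (inl i).
  rewrite add0r; apply: (is_derive_along (h := W) (a := coord (inl i) x)).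
    move=> s; rewrite !coord_basis eqxx mulr1 [_ == _]/= mulr0 add0r.
    by rewrite [s *: _]mulr1; ring.
  exact: cinfty_is_derive.
rewrite addr0; apply: (is_derive_along (h := cst 0) (a := 0)).
  move=> s; rewrite !coord_basis ![_ == c]eq_sym (negbTE ci) (negbTE ci').
  by rewrite mulr0 !add0r subrr oppr0.
Qed.

Lemma cinfty0 : cinfty (cst 0 : R -> R).
Proof.
rewrite (_ : cst 0 = horner (0 : {poly R})); first exact: cinfty_horner.
by apply/funext => t; rewrite horner0.
Qed.

Lemma partial_separable (i : 'I_n) (T W : R -> R) c :
  cinfty T -> cinfty W ->
  partial c (separable i T W) = separable i
    (if c == inr i then derive1 T else cst 0)
    (if c == inl i then derive1 W else cst 0).
Proof.
move=> CT CW; apply/funext => x.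
by have [_] := is_derive_separable i x c CT CW.
Qed.

Lemma smooth_separable (i : 'I_n) (T W : R -> R) :
  cinfty T -> cinfty W -> smooth (separable i T W).
Proof.
move=> CT CW s.
have [T' [W' [CT' CW' ->]]] : exists T' W', [/\ cinfty T', cinfty W' &
    foldr partial (separable i T W) s = separable i T' W'].
  elim: s => [|c s [T' [W' [CT' CW' sE]]]]; first by exists T, W.
  rewrite /= sE partial_separable//.
  exists (if c == inr i then derive1 T' else cst 0).
  exists (if c == inl i then derive1 W' else cst 0); split=> //.
    by case: ifP => _; [exact: cinfty_derive1|exact: cinfty0].
  by case: ifP => _; [exact: cinfty_derive1|exact: cinfty0].
split=> [x|x c]; last by have [] := is_derive_separable i x c CT' CW'.
apply: cvgD.
  apply: (continuous_comp (f := coord (inr i)) (g := T')).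
    exact: continuous_coord.
  exact: cinfty_continuous.
apply: (continuous_comp (f := coord (inl i)) (g := W')).
  exact: continuous_coord.
exact: cinfty_continuous.
Qed.

Lemma with_potential_separable (i : 'I_n) (W : R -> R) :
  with_potential i W = separable i (horner (2^-1 *: 'X^2)) W.
Proof.
apply/funext => x.
by rewrite /separable !hornerE /with_potential /kinetic mulrC expr2 mulrA.
Qed.

Lemma smooth_with_potential (i : 'I_n) (W : R -> R) :
  cinfty W -> smooth (with_potential i W : E -> R).
Proof.
move=> CW; rewrite with_potential_separable.
by apply: smooth_separable => //; exact: cinfty_horner.
Qed.

Lemma near_partial c f g x :
  (\near x, f x = g x) -> \near x, partial c f x = partial c g x.
Proof. by move=> /near_join; apply: filterS => y; exact: near_eq_derive. Qed.

Lemma near_mpartial (alpha : C -> nat) f g x :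
  (\near x, f x = g x) -> mpartial alpha f x = mpartial alpha g x.
Proof.
move=> fg; apply: (@nbhs_singleton _ x [set x | _ x = _ x]).
have near_foldr (c : 'I_n -> C) f' g' (s : seq 'I_n) :
    (\near x, f' x = g' x) -> \near x,
    foldr (fun i h => iter (alpha (c i)) (partial (c i)) h) f' s x =
    foldr (fun i h => iter (alpha (c i)) (partial (c i)) h) g' s x.
  move=> fg'; elim: s => [//|i s IH] /=.
  by elim: (alpha (c i)) => [//|k IHk] /=; exact: near_partial.
exact/near_foldr/near_foldr.
Qed.

Lemma mpartial_with_potential (alpha : C -> nat) (i : 'I_n) (W : R -> R) (u v : R) x :
  (forall t, ~~ (u < t < v) -> W t = 0) ->
  (x.1 0 i < u) || (v < x.1 0 i) ->
  mpartial alpha (with_potential i W) x = mpartial alpha (kinetic i) x.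
Proof.
move=> W0 xuv; apply: near_mpartial.
have qc := @continuous_coord R n (inl i) x.
suff : \forall y \near x, ~~ (u < coord (inl i) y < v).
  by apply: filterS => y /W0; rewrite /with_potential /= => ->; rewrite addr0.
case/orP: xuv => [xu|vx].
  have /cvgr_lt/(_ _ xu) := qc; apply: filterS => y yu.
  by rewrite negb_and -!leNgt ltW.
have /cvgr_gt/(_ _ vx) := qc; apply: filterS => y vy.
by rewrite negb_and -!leNgt (ltW vy) orbT.
Qed.

End Smoothness.

(** * Integrators *)

Section Integrator.
Context {R : realType} {n : nat}.
Local Notation E := (phase R n).
Local Notation C := ('I_n + 'I_n)%type.
Implicit Types (x y : E) (U : set E) (c : C) (Phi : integrator R n).

(** Each listed number is avoided by shrinking the interval to a part on one side of it. *)
Lemma interval_avoiding (L : seq R) (a b : R) : a < b -> exists u v,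
  [/\ a < u, u < v, v < b & forall z, z \in L -> (z < u) || (v < z)].
Proof.
move=> ab; elim: L => [|z L [u [v [au uv vb uvL]]]].
  by exists ((a + a + b) / 3), ((a + b + b) / 3); split => //; lra.
have [zuv|zuv] := ltP z ((u + v) / 2).
  exists ((u + v) / 2), v; split => //; [lra|lra|move=> w].
  rewrite inE => /predU1P[->|/uvL /orP[wu|->]]; rewrite ?zuv ?orbT//.
  by rewrite (lt_trans wu)//; lra.
(* A third instead of a half, since [z] may be the midpoint itself. *)
exists u, ((u + u + v) / 3); split => //; [lra|lra|move=> w].
rewrite inE => /predU1P[->|/uvL /orP[->//|vw]].
  by apply/orP; right; lra.
by apply/orP; right; lra.
Qed.

Lemma coord_lt_norm x c (e : R) : `|x| < e -> `|coord c x| < e.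
Proof.
move=> xe; have : ball (0 : E) e x by rewrite -ball_normE/= sub0r normrN.
move=> [[_ h1] [_ h2]]; case: c => k.
  by have := h1 0 k; rewrite /ball/= mxE sub0r normrN.
by have := h2 0 k; rewrite /ball/= mxE sub0r normrN.
Qed.

(** The flow deviates from its linear part by less than dt/2, and by consistency the integrator
    deviates from the flow by less than dt/2. Such a coarse bound suffices to place the images of
    the two axis points. *)
Lemma consistent_first_order Phi (H : E -> R) (S : R -> E -> E) x :
  is_hamiltonian_flow H S -> consistent_at Phi H S x ->
  \forall dt \near 0^'+, exists2 y, Phi H x dt = Some y &
    forall c, `|coord c y - coord c x - dt * coord c (hamiltonian_field H x)| < dt.
Proof.
move=> flow [psi [Phipsi err]].
have [S0 /(_ 0)] := flow x; rewrite S0 => -[dS eS].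
pose F := hamiltonian_field H x.
have quot : (fun h : R => h^-1 *: (S h x - x)) @ 0^' --> F.
  have : (fun h : R => h^-1 *: (((S^~ x) \o shift 0) (h *: 1) - S 0 x)) @ 0^' --> F.
    by rewrite /F -eS; exact: dS.
  rewrite S0; apply: cvg_trans; apply: near_eq_cvg; near=> h.
  by rewrite /= addr0 [h *: 1]mulr1.
have quotc c : \forall dt \near 0^'+,
    `|coord c F - coord c (dt^-1 *: (S dt x - x))| < 1 / 2.
  have cc : coord c \o (fun h : R => h^-1 *: (S h x - x)) @ 0^'+ --> coord c F.
    apply: cvg_dnbhs_at_right.
    exact: cvg_comp quot (@continuous_coord _ _ c F).
  by have /cvgrPdist_lt/(_ (1 / 2)) := cc; apply; lra.
near=> dt.
have dt0 : 0 < dt by [].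
exists (psi dt); first by near: dt.
move=> c.
have : `|coord c F - coord c (dt^-1 *: (S dt x - x))| < 1 / 2.
  move: c; near: dt.
  apply: (@filter_forall R C (fun c => [set dt |
    `|coord c F - coord c (dt^-1 *: (S dt x - x))| < 1 / 2])).
  exact: quotc.
have : `|S dt x - psi dt| / dt < 1 / 2.
  near: dt; have /cvgrPdist_lt/(_ (1 / 2)) := err.
  move=> /(_ ltac:(lra)); apply: filterS => h; rewrite sub0r normrN.
  exact: le_lt_trans (ler_norm _).
rewrite ltr_pdivrMr// => /(@coord_lt_norm _ c).
have -> : coord c (S dt x - psi dt) = coord c (S dt x) - coord c (psi dt).
  by case: c => k; rewrite /= !mxE.
have -> : coord c (dt^-1 *: (S dt x - x)) = dt^-1 * (coord c (S dt x) - coord c x).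
  by case: c => k; rewrite /= !mxE.
move=> h1 h2.
have : `|dt * coord c F - (coord c (S dt x) - coord c x)| < 1 / 2 * dt.
  have -> : dt * coord c F - (coord c (S dt x) - coord c x) =
      dt * (coord c F - dt^-1 * (coord c (S dt x) - coord c x)).
    by field; rewrite gt_eqF.
  by rewrite normrM (gtr0_norm dt0) mulrC ltr_pM2r.
move: h1; rewrite -/F !ltr_norml => /andP[h3 h4] /andP[h5 h6].
apply/andP; split; lra.
Unshelve. all: by end_near. Qed.

End Integrator.

(** * The contradiction between the free step and the perturbed step *)

Section Obstruction.
Context {R : realType} {n : nat}.
Local Notation E := (phase R n).
Local Notation C := ('I_n + 'I_n)%type.
Implicit Types (x y : E) (U : set E) (c : C) (Phi : integrator R n).

Lemma kinetic_potential (i : 'I_n) : kinetic i = with_potential i (cst 0) :> (E -> R).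
Proof. by apply/funext => x; rewrite /with_potential addr0. Qed.

Lemma hamiltonian_field_coord (H : E -> R) x (k : 'I_n) :
  coord (inl k) (hamiltonian_field H x) = partial (inr k) H x /\
  coord (inr k) (hamiltonian_field H x) = - partial (inl k) H x.
Proof. by split; rewrite /coord/hamiltonian_field /fst /snd !mxE. Qed.

Lemma hamiltonian_field_kinetic (i : 'I_n) (s : R) :
  let F : E := hamiltonian_field (kinetic i) (axis_point i s) in
  coord (inl i) F = 1 /\ coord (inr i) F = 0.
Proof.
move=> F; have [-> ->] := hamiltonian_field_coord (kinetic i) (axis_point i s) i.
rewrite kinetic_potential with_potential_separable.
have Ch : cinfty (horner (2^-1 *: 'X^2 : {poly R})) by exact: cinfty_horner.
rewrite (partial_separable i (inr i) Ch (@cinfty0 R)).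
rewrite (partial_separable i (inl i) Ch (@cinfty0 R)).
have -> : (inl i == inr i :> C) = false by [].
have -> : (inr i == inl i :> C) = false by [].
rewrite !eqxx /separable p_axis.
have -> : derive1 (cst 0 : R -> R) (coord (inl i) (axis_point i s)) = 0.
  by rewrite derive1E derive_cst.
rewrite !addr0 oppr0; split => //.
have [_ D] := is_derive_poly (2^-1 *: 'X^2) (1 : R).
by rewrite derive1E D derivZ derivXn !hornerE/=; lra.
Qed.

Lemma kinetic_first_order (i : 'I_n) Phi (S : R -> E -> E) (s : R) :
  is_hamiltonian_flow (kinetic i) S ->
  consistent_at Phi (kinetic i) S (axis_point i s) ->
  \forall dt \near 0^'+, exists y,
    [/\ Phi (kinetic i) (axis_point i s) dt = Some y,
        s < coord (inl i) y < s + dt *+ 2 & 1 - dt < coord (inr i) y].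
Proof.
move=> flow /(consistent_first_order flow).
apply: filterS => dt [y PhiE yP]; exists y; split => //.
  have := yP (inl i); rewrite (hamiltonian_field_kinetic i s).1 q_axis mulr1.
  by rewrite ltr_norml => /andP[? ?]; apply/andP; split; lra.
have := yP (inr i); rewrite (hamiltonian_field_kinetic i s).2 p_axis mulr0 subr0.
by rewrite ltr_norml => /andP[? ?]; lra.
Qed.

Section Regular.
Context (i : 'I_n) (U : set E) (Phi : integrator R n) (dt : R).
Hypothesis openU : open U.
Hypothesis axisU : axis_line i `<=` U.
Hypothesis Phi_energy : energy_conserving Phi.
Hypothesis Phi_decoupled : preserves_decoupled Phi.
Hypothesis dt0 : 0 <= dt.

(** A potential in q_i leaves every other pair (q_k, p_k) out of the Hamiltonian, so all of them are
    frozen; as [U] is open, continuity within [U] becomes continuity at each of its points. *)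
Lemma regular_step_properties (W : R -> R) : cinfty W ->
  regular_step_on U Phi (with_potential i W) dt ->
  exists Psi : E -> E,
    (forall x, U x -> Phi (with_potential i W) x dt = Some (Psi x)) /\
    [/\ forall x, U x -> {for x, continuous Psi},
        volume_conserving_on U Psi,
        forall x, U x ->
          coord (inr i) (Psi x) ^+ 2 / 2 + W (coord (inl i) (Psi x)) =
          coord (inr i) x ^+ 2 / 2 + W (coord (inl i) x) &
        forall x c, U x -> c != inl i -> c != inr i ->
          coord c (Psi x) = coord c x].
Proof.
move=> CW [Psi [PhiE Psi_cont Psi_vol]]; exists Psi; split; first exact: PhiE.
have smW := @smooth_with_potential R n i W CW; split; [|exact: Psi_vol|..].
- move=> x Ux; have := Psi_cont; rewrite continuous_open_subspace; last exact: openU.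
  by move=> /(_ x); apply; rewrite inE.
- by move=> x Ux; exact: (Phi_energy smW dt0 (PhiE x Ux)).
- move=> x c Ux ci ci'.
  have rest k : k != i -> (Psi x).1 0 k = x.1 0 k /\ (Psi x).2 0 k = x.2 0 k.
    move=> ki; apply: (Phi_decoupled smW dt0 _ (PhiE x Ux)).
    move=> y z yz; have [yz1 yz2] := yz i (contra_neq esym ki).
    by rewrite /with_potential /kinetic yz1 yz2.
  by case: c ci ci' => k ci ci'; have [] := rest k.
Qed.

Hypothesis Phi_reasonable : computationally_reasonable Phi.
Context (y0 y1 : E).
Hypothesis Phi0 : Phi (kinetic i) (axis_point i 0) dt = Some y0.
Hypothesis Phi1 : Phi (kinetic i) (axis_point i 1) dt = Some y1.
Hypothesis q0 : coord (inl i) y0 < 1.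
Hypothesis q1 : 1 < coord (inl i) y1.
Hypothesis p0 : 0 < coord (inr i) y0.

(** Both steps share the images [y0] and [y1], so [free_shift_ge] without potential and [stretch_le]
    with [W] bound the same difference from opposite sides. *)
Lemma potential_irregular (u v : R) (W : R -> R) :
  regular_step_on U Phi (kinetic i) dt ->
  Phi (with_potential i W) (axis_point i 0) dt = Some y0 ->
  Phi (with_potential i W) (axis_point i 1) dt = Some y1 ->
  1 < u -> u < v -> v < coord (inl i) y1 ->
  cinfty W -> (forall t, 0 <= W t <= 1 / 4) ->
  (forall t, ~~ (u < t < v) -> W t = 0) -> 0 < W ((u + v) / 2) ->
  ~ regular_step_on U Phi (with_potential i W) dt.
Proof.
move=> regH PhiW0 PhiW1 u1 uv vq CW Wb Wuv Wm regW.
have ge1 : 1 - 0 <= coord (inl i) y1 - coord (inl i) y0.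
  have := Phi0; have := Phi1; rewrite kinetic_potential in regH *.
  move=> Phi1' Phi0'; have [Psi [PhiE [cont vol en rest]]] := regular_step_properties (@cinfty0 R) regH.
  have PE0 : Psi (axis_point i 0) = y0.
    have := PhiE _ (axisU (axis_point_line i 0)).
    by rewrite Phi0' => -[].
  have PE1 : Psi (axis_point i 1) = y1.
    have := PhiE _ (axisU (axis_point_line i 1)).
    by rewrite Phi1' => -[].
  rewrite -PE0 -PE1.
  apply: (@free_shift_ge _ _ i (cst 0) U Psi) => //.
  - by move=> t; rewrite /cst lexx/=; lra.
  - by rewrite PE0.
  - by rewrite PE0 PE1; exact: lt_trans q0 q1.
have [Psi [PhiE [cont vol en rest]]] := regular_step_properties CW regW.
have PE0 : Psi (axis_point i 0) = y0.
  by have := PhiE _ (axisU (axis_point_line i 0)); rewrite PhiW0 => -[].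
have PE1 : Psi (axis_point i 1) = y1.
  by have := PhiE _ (axisU (axis_point_line i 1)); rewrite PhiW1 => -[].
have m1 : 1 < (u + v) / 2 by lra.
set m := (u + v) / 2 in Wm m1.
(* A constant floor under [W] is needed on some interval: half the midpoint value works just to the
   right of [m], and staying below [v] keeps that interval below the image of 1. *)
have : \forall t \near m, W m / 2 < W t.
  have /cvgr_gt := @cinfty_continuous R W CW m.
  by apply; lra.
move=> /nbhs_ballP[e /= e0 We].
have [d [d0 de dv]] : exists d, [/\ 0 < d, d < e & d < v - m].
  exists (Num.min e (v - m) / 2).
  have d0 : 0 < Num.min e (v - m) by rewrite lt_min e0 /m; lra.
  split; first exact: divr_gt0.
    by rewrite ltr_pdivrMr// gt_min; apply/orP; left; lra.
  by rewrite ltr_pdivrMr// gt_min; apply/orP; right; rewrite /m; lra.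
pose k := m + d.
have := @stretch_le _ _ i W U Psi openU axisU cont vol en rest Wb 0 1 m k (W m / 2).
lazy beta zeta; rewrite PE0 PE1.
have q01 : coord (inl i) y0 <= coord (inl i) y1 by lra.
rewrite (min_l q01) (max_r q01) => /(_ ltr01) H.
have [] : ~ (`|coord (inl i) y1 - coord (inl i) y0| + W m / 2 * (k - m) <= 1 - 0).
  have : 0 < W m / 2 * (k - m) by rewrite mulr_gt0 /k//; lra.
  by have := ler_norm (coord (inl i) y1 - coord (inl i) y0); lra.
apply: H => //.
- move=> r /andP[_ r1]; apply: Wuv; rewrite negb_and -leNgt.
  by rewrite (le_trans r1) ?ltW.
- by lra.
- move=> r /andP[mr rk]; apply/ltW/We.
  by rewrite /ball/= ltr_norml; move: rk; rewrite /k => rk; apply/andP; split; lra.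
- exact: lt_trans q0 m1.
- by rewrite /k lerDl ltW.
- by rewrite (lt_trans _ vq)// /k -ltrBrDl.
Qed.

(** The list comes from the kinetic energy alone, so it is fixed before any potential is chosen and
    one list serves them all. *)
Lemma sample_points s : exists L : seq R, forall (u v : R) (W : R -> R),
  (forall z, z \in L -> (z < u) || (v < z)) -> cinfty W ->
  (forall t, ~~ (u < t < v) -> W t = 0) ->
  Phi (with_potential i W) (axis_point i s) dt =
  Phi (kinetic i) (axis_point i s) dt.
Proof.
have smK : smooth (kinetic i : E -> R).
  by rewrite kinetic_potential; exact/smooth_with_potential/cinfty0.
have [m [r [alpha rP]]] := Phi_reasonable (axis_point i s) smK dt0.
exists [seq (r j).1 0 i | j <- enum 'I_m] => u v W avoid CW Wuv.
apply/esym/rP; first exact: smooth_with_potential.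
move=> j; apply: mpartial_with_potential Wuv _.
by apply: avoid; apply: map_f; rewrite mem_enum.
Qed.

Lemma potential_exists : regular_step_on U Phi (kinetic i) dt ->
  exists V : R -> R,
    [/\ test_function V,
        ~ regular_step_on U Phi (with_potential i V) dt &
        forall lambda : R, 0 < lambda < 1 ->
          ~ regular_step_on U Phi
              (with_potential i (fun t => lambda * V t)) dt].
Proof.
move=> regH; have [L0 L0P] := sample_points 0; have [L1 L1P] := sample_points 1.
have [u [v [u1 uv vq avoid]]] := interval_avoiding (L0 ++ L1) q1.
have avoid0 z : z \in L0 -> (z < u) || (v < z).
  by move=> zL; apply: avoid; rewrite mem_cat zL.
have avoid1 z : z \in L1 -> (z < u) || (v < z).
  by move=> zL; apply: avoid; rewrite mem_cat zL orbT.
have [V [VC Vb Vuv Vm]] := bump_exists uv; have CV : cinfty V := VC.1.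
(* Stated for every [W] on the same []u, v[], so that it covers [V] and all its multiples by a
   factor in []0, 1[]. *)
have irr W : cinfty W -> (forall t, 0 <= W t <= 1 / 4) ->
    (forall t, ~~ (u < t < v) -> W t = 0) -> 0 < W ((u + v) / 2) ->
    ~ regular_step_on U Phi (with_potential i W) dt.
  move=> CW Wb Wuv Wm; apply: (potential_irregular regH _ _ u1 uv vq) => //.
    by rewrite (L0P u v).
  by rewrite (L1P u v).
exists V; split => //; first exact: irr.
move=> a /andP[a0 a1]; apply: irr.
- exact: cinftyZ.
- move=> t; have /andP[Vt0 Vt1] := Vb t; apply/andP; split; nra.
- by move=> t /Vuv ->; rewrite mulr0.
- exact: mulr_gt0.
Qed.

End Regular.
End Obstruction.

Theorem theorem2 (R : realType) (n : nat) (hn : (2 <= n)%N)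
    (Phi : integrator R n) (S : R -> phase R n -> phase R n)
    (U : set (phase R n)) :
  let i1 : 'I_n := Ordinal (ltnW hn) in
  let H : phase R n -> R := kinetic i1 in
  is_hamiltonian_flow H S ->
  open U -> axis_line i1 `<=` U ->
  (forall x : phase R n, consistent_at Phi H S x) ->
  computationally_reasonable Phi ->
  energy_conserving Phi ->
  preserves_decoupled Phi ->
  (\forall dt \near (0 : R)^'+, regular_step_on U Phi H dt) ->
  \forall dt \near (0 : R)^'+,
    exists V : R -> R,
      [/\ test_function V,
          ~ regular_step_on U Phi (with_potential i1 V) dt &
          forall lambda : R, 0 < lambda < 1 ->
            ~ regular_step_on U Phi
                (with_potential i1 (fun t => lambda * V t)) dt].
Proof.
move=> i1 H flow openU axisU consistent reasonable energy decoupled regular.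
have near0 := kinetic_first_order flow (consistent (axis_point i1 0)).
have near1 := kinetic_first_order flow (consistent (axis_point i1 1)).
(* With [dt < 1 / 2] the image of 0 stays below [dt *+ 2 < 1] and its momentum above
   [1 - dt > 0]. *)
have small : \forall dt \near (0 : R)^'+, 0 < dt /\ dt < 1 / 2.
  near=> dt; split; first by [].
  by near: dt; apply: nbhs_right_lt; lra.
apply: filterS (filterI (filterI near0 near1) (filterI regular small)).
move=> dt [[[y0 [Phi0 /andP[_ q0] p0]] [y1 [Phi1 /andP[q1 _] _]]]].
move=> [regular_dt [dt0 dt_small]].
apply: (potential_exists openU axisU energy decoupled (ltW dt0) reasonable
  Phi0 Phi1 _ q1 _ regular_dt).
  by apply: lt_le_trans q0 _; lra.
by apply: lt_trans p0; lra.
Unshelve. all: by end_near. Qed.
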